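(* Let $\mathrm{DA}=[0,1]\times\{0,1\}$ be the double arrow space and let $\pi_1:\mathrm{DA}\to[0,1]$ be the first projection. The subalgebra $\pi_1^*C[0,1]=\{f\circ\pi_1: f\in C[0,1]\}$ does not have the $c_0$-extension property in the Banach space $C(\mathrm{DA})$.
   Context: The double arrow space is the set $\mathrm{DA}=[0,1]\times\{0,1\}$ endowed with the lexicographic order and the order topology; it is compact Hausdorff, and $\pi_1$ is a continuous increasing surjection. For a compact Hausdorff space $K$, $C(K)$ denotes the Banach space of real-valued continuous functions on $K$ with the supremum norm. A closed subspace $Y$ of a (real) Banach space $X$ has the $c_0$-extension property in $X$ if every bounded linear operator $T:Y\to c_0$ admits a bounded linear extension $X\to c_0$. *)

(* Defs.v *)
From HB Require Import structures.
From mathcomp Require Import all_boot all_order all_algebra.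
From mathcomp Require Import all_classical all_reals all_analysis.
From mathcomp Require Import ring.

Set Implicit Arguments.
Unset Strict Implicit.
Unset Printing Implicit Defensive.

Import Order.TTheory GRing.Theory Num.Theory.
Import numFieldNormedType.Exports.

Local Open Scope classical_set_scope.
Local Open Scope ring_scope.

HB.mixin Record isCompactHausdorff K of Topological K := {
  compact_setT : compact [set: K] ;
  hausdorff_setT : hausdorff_space K }.

#[short(type="compactHausdorffType")]
HB.structure Definition CompactHausdorff :=
  {K of Topological K & isCompactHausdorff K}.

(* [0, 1], with the topology and the order inherited from R *)
Definition unit_itv (R : realType) : Type := (`[0%R, 1%R]%classic : set R).

HB.instance Definition _ (R : realType) :=
  SubChoice.copy (unit_itv R) (set_type (`[0%R, 1%R]%classic : set R)).
HB.instance Definition _ (R : realType) :=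
  Topological.copy (unit_itv R) (set_type (`[0%R, 1%R]%classic : set R)).
HB.instance Definition _ (R : realType) :=
  [SubChoice_isSubOrder of unit_itv R by <: with ring_display].

Section unit_itv_lemmas.
Variable R : realType.
Implicit Types t : unit_itv R.

Lemma unit_itv_ge0 t : 0 <= val t.
Proof. by have := valP t; rewrite inE /= in_itv /= => /andP[]. Qed.

Lemma unit_itv_le1 t : val t <= 1.
Proof. by have := valP t; rewrite inE /= in_itv /= => /andP[]. Qed.

Lemma unit_itv_subproof (a : R) : 0 <= a -> a <= 1 -> a \in `[0, 1]%classic.
Proof. by move=> a0 a1; rewrite inE /= in_itv /= a0 a1. Qed.

Definition to_unit_itv (a : R) (a0 : 0 <= a) (a1 : a <= 1) : unit_itv R :=
  exist _ a (unit_itv_subproof a0 a1).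

Lemma unit_itv_val_continuous : continuous (val : unit_itv R -> R).
Proof. exact: (@initial_continuous _ _ (val : unit_itv R -> R)). Qed.

Lemma unit_itv_compact : compact [set: unit_itv R].
Proof.
move=> F FF _.
have [p [p01 cp]] : `[0, 1]%classic `&` cluster (val @ F : set_system R) !=set0.
  apply: segment_compact.
  by apply: (@filterS _ F _ setT) => [t _|]; [exact: set_mem (valP t)|exact: filterT].
exists (exist _ p (mem_set p01)); split => // A B FA.
case=> _ [[W oW <-] /= Wp WB].
have [||_ [[t At <-] Wt]] := cp (val @` A) W.
- by apply: (@filterS _ F _ A) FA => t At; exists t.
- exact: open_nbhs_nbhs.
- by exists t; split => //; exact: WB.
Qed.

Lemma unit_itv_hausdorff : hausdorff_space (unit_itv R).
Proof.
move=> p q pq; apply: val_inj; apply: Rhausdorff => A B pA qB.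
have [t [At Bt]] := pq _ _ (unit_itv_val_continuous pA)
  (unit_itv_val_continuous qB).
by exists (val t).
Qed.

HB.instance Definition _ :=
  isCompactHausdorff.Build (unit_itv R) unit_itv_compact unit_itv_hausdorff.

End unit_itv_lemmas.

Lemma complete_order_compact d (T : orderTopologicalType d) (b : T) :
  (forall x, (b <= x)%O) ->
  (forall A : set T, A !=set0 -> exists2 s, ubound A s & lbound (ubound A) s) ->
  compact [set: T].
Proof.
move=> bmin supT; rewrite compact_ultra => F FF _.
pose L := [set x : T | F [set y | (x <= y)%O]].
have [|s Ls sL] := supT L; first by exists b; apply: filterS filterT => y _ /=.
exists s; split => // U; rewrite itv_nbhsE => -[[p q] [oi si] iU].
apply: filterS iU _.
move: si; rewrite itv_boundlr /= => /andP[ps sq].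
have FP : F [set y : T | p <= BLeft y]%O.
  case: p oi ps => [a x|a oi ps].
    move=> /itv_open_ends_lside ->; rewrite bnd_simp => xs.
    have [z Lz xz] : exists2 z, L z & (x < z)%O.
      apply: contrapT => /forall2NP H.
      have : ubound L x by move=> z Lz; rewrite leNgt; apply/negP; case: (H z).
      by move=> /sL; rewrite leNgt xs.
    by apply: filterS Lz => y zy /=; rewrite bnd_simp; exact: lt_le_trans zy.
  rewrite (itv_open_ends_linfty oi).
  by apply: filterS filterT => y _ /=; rewrite bnd_simp.
have FQ : F [set y : T | BRight y <= q]%O.
  case: q oi sq => [a x|a oi sq].
    move=> /itv_open_ends_rside ->; rewrite bnd_simp => sx.
    have [Lx|] := in_ultra_setVsetC [set y | (x <= y)%O] FF.
      by have := Ls _ Lx; rewrite leNgt sx.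
    by apply: filterS => y /= /negP; rewrite -ltNge bnd_simp.
  rewrite (itv_open_ends_rinfty oi).
  by apply: filterS filterT => y _ /=; rewrite bnd_simp.
by apply: filterS2 FP FQ => y /= py yq; rewrite itv_boundlr /= py.
Qed.

(* {0, 1} is encoded by [bool], for which false < true. The alias
   [order_topology] forgets the product topology. *)
Definition double_arrow (R : realType) : Type :=
  order_topology (unit_itv R *l bool)%type.

HB.instance Definition _ (R : realType) := OrderTopological.copy
  (double_arrow R) (order_topology (unit_itv R *l bool)%type).

Section double_arrow_lemmas.
Variable R : realType.
Local Notation DA := (double_arrow R).

Definition pi1 (z : DA) : unit_itv R := z.1.


Lemma double_arrow_le (x y : DA) :
  (x <= y)%O = (x.1 <= y.1)%O && ((y.1 <= x.1)%O ==> (x.2 <= y.2)%O).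
Proof. by []. Qed.

Lemma double_arrow_lt (x y : DA) :
  (x < y)%O = (x.1 <= y.1)%O && ((y.1 <= x.1)%O ==> (x.2 < y.2)%O).
Proof. by []. Qed.

Let zero : unit_itv R := to_unit_itv (lexx 0) ler01.

Lemma double_arrow_compact : compact [set: DA].
Proof.
apply: (@complete_order_compact _ DA (zero, false)) => [x|A [x0 Ax0]].
  rewrite double_arrow_le /=; apply/andP; split; last exact/implyP.
  by rewrite leEsub /= unit_itv_ge0.
pose B := [set val (pi1 x) | x in A].
have B0 : B !=set0 by exists (val (pi1 x0)), x0.
have ubB : ubound B 1 by move=> _ [x _ <-]; exact: unit_itv_le1.
have sB : has_sup B by split => //; exists 1.
have s0 : 0 <= sup B.
  apply: le_trans (unit_itv_ge0 (pi1 x0)) _.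
  by apply: ub_le_sup; [case: sB|exists x0].
have s1 : sup B <= 1 by apply: ge_sup.
pose a := to_unit_itv s0 s1.
have ubA x : A x -> (x.1 <= a)%O.
  by move=> Ax; rewrite leEsub /=; apply: ub_le_sup; [case: sB|exists x].
have [Aa|nAa] := pselect (A (a, true)).
  exists (a, true) => [x Ax|u]; last exact.
  by rewrite double_arrow_le /= ubA //=; apply/implyP => _; case: (x.2).
exists (a, false) => [[x i] Ax|u ubu].
  rewrite double_arrow_le /= (ubA _ Ax) /=; apply/implyP => ax.
  case: i Ax => // Ax; case: nAa.
  by have /le_anti <- : (x <= a <= x)%O by rewrite ax andbT (ubA _ Ax).
rewrite double_arrow_le /=; apply/andP; split; last exact/implyP.
rewrite leEsub /=; apply: ge_sup => // _ [x Ax <-].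
by have := ubu _ Ax; rewrite double_arrow_le leEsub => /andP[].
Qed.

HB.instance Definition _ := isCompactHausdorff.Build DA
  double_arrow_compact order_hausdorff.

Lemma pi1_continuous : continuous pi1.
Proof.
have oL (a : R) : open [set z : DA | val (pi1 z) < a].
  have [a0|a0] := leP a 0.
    rewrite (_ : [set _ | _] = set0); first exact: open0.
    apply/seteqP; split => // z /=.
    by rewrite ltNge (le_trans a0 (unit_itv_ge0 _)).
  have [a1|a1] := ltP 1 a.
    rewrite (_ : [set _ | _] = setT); first exact: openT.
    by apply/seteqP; split => // z _ /=; apply: le_lt_trans a1; exact: unit_itv_le1.
  pose p : DA := (to_unit_itv (ltW a0) a1, false).
  rewrite (_ : [set _ | _] = `]-oo, p[%classic); first exact: lray_open.
  apply/seteqP; split => -[t i] /=; rewrite in_itv /= double_arrow_lt /= !leEsub /=.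
    by move=> ta; rewrite (ltW ta) leNgt ta.
  move=> /andP[ta /implyP H]; rewrite ltNge; apply/negP => /H.
  by case: i {H}.
have oR (a : R) : open [set z : DA | a < val (pi1 z)].
  have [a1|a1] := leP 1 a.
    rewrite (_ : [set _ | _] = set0); first exact: open0.
    apply/seteqP; split => // z /=.
    by rewrite ltNge (le_trans (unit_itv_le1 _) a1).
  have [a0|a0] := ltP a 0.
    rewrite (_ : [set _ | _] = setT); first exact: openT.
    by apply/seteqP; split => // z _ /=; apply: lt_le_trans a0 _; exact: unit_itv_ge0.
  pose p : DA := (to_unit_itv a0 (ltW a1), true).
  rewrite (_ : [set _ | _] = `]p, +oo[%classic); first exact: rray_open.
  apply/seteqP; split => -[t i] /=; rewrite in_itv /= andbT double_arrow_lt /= !leEsub /=.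
    by move=> ta; rewrite (ltW ta) leNgt ta.
  move=> /andP[ta /implyP H]; rewrite ltNge; apply/negP => /H.
  by case: i {H}.
move=> z U; case=> V [[W oW <-] /= Wz] WU.
have /nbhs_ballP[e /= e0 eW] : nbhs (val (pi1 z)) W by exact: open_nbhs_nbhs.
have : nbhs z ([set z' : DA | val (pi1 z') < val (pi1 z) + e] `&`
               [set z' : DA | val (pi1 z) - e < val (pi1 z')]).
  apply: open_nbhs_nbhs; split; first exact: openI.
  by split => /=; rewrite ?ltrDl // ltrBlDr ltrDl.
apply: filterS => z' /= [h1 h2]; apply: WU => /=; apply: eW.
by rewrite /ball /= ltr_distlC h1 h2.
Qed.

HB.instance Definition _ := isContinuous.Build _ _ pi1 pi1_continuous.

End double_arrow_lemmas.

(* An alias of [continuousType], so that the topology of C(K) is the one of the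
   supremum norm; that norm requires K compact and is set up further below. *)
Definition cfun (K : topologicalType) (R : realType) : Type :=
  continuousType K R.

Section cfun_lmodType.
Variables (K : topologicalType) (R : realType).

Definition cfun_pred : {pred K -> R} := mem [set f : K -> R | continuous f].

Let Sub_subproof (f : K -> R) (fP : f \in cfun_pred) : cfun K R := mkcts (set_mem fP).

Let cfun_rect (P : cfun K R -> Type) :
  (forall f (fP : f \in cfun_pred), P (Sub_subproof fP)) -> forall u, P u.
Proof.
move=> PSub [f [[cf]]].
rewrite (_ : cf = set_mem (mem_set cf : f \in cfun_pred)); last exact: Prop_irrelevance.
exact: PSub.
Qed.

Let valP (f : K -> R) (fP : f \in cfun_pred) : (Sub_subproof fP : K -> R) = f.
Proof. by []. Qed.

HB.instance Definition _ := isSub.Build _ _ (cfun K R) cfun_rect valP.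
HB.instance Definition _ := Choice.copy (cfun K R) (continuousType K R).

Let cfun_submod_closed : submod_closed cfun_pred.
Proof.
split=> [|a f g]; first by rewrite inE /= => x; exact: cvg_cst.
rewrite !inE /= => cf cg x.
by apply: cvgD; [apply: cvgZl_tmp; exact: cf|exact: cg].
Qed.

HB.instance Definition _ :=
  GRing.isSubmodClosed.Build R (K -> R) cfun_pred cfun_submod_closed.
HB.instance Definition _ := [SubChoice_isSubLmodule of cfun K R by <:].

End cfun_lmodType.

Section sup_norm.
Variables (T : Type) (R : realType).
Implicit Types f g : T -> R.

(* The value is 0 if T is empty, and also if f is unbounded; f is bounded
   wherever this is used as a norm. *)
Definition sup_norm f : R := sup [set `|f x| | x in [set: T]].

Definition sup_normed f := has_ubound [set `|f x| | x in [set: T]].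

Lemma le_sup_norm f x : sup_normed f -> `|f x| <= sup_norm f.
Proof. by move=> bf; apply: ub_le_sup => //; exists x. Qed.

Lemma sup_norm_le f (M : R) :
  0 <= M -> (forall x, `|f x| <= M) -> sup_norm f <= M.
Proof.
move=> M0 fM; have [T0|/set0P T0] := eqVneq [set: T] set0.
  by rewrite /sup_norm T0 image_set0 sup0.
apply: ge_sup; first by case: T0 => x _; exists `|f x|, x.
by move=> _ [x _ <-].
Qed.

Lemma sup_norm_ge0 f : 0 <= sup_norm f.
Proof.
have [hs|/sup_out] := pselect (has_sup [set `|f x| | x in [set: T]]); last first.
  by rewrite /sup_norm => ->.
case: hs => -[r [x xT xr]] hs.
by apply: le_trans (normr_ge0 (f x)) _; exact: le_sup_norm.
Qed.

Lemma ler_sup_normD f g : sup_normed f -> sup_normed g ->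
  sup_norm (f + g) <= sup_norm f + sup_norm g.
Proof.
move=> bf bg; apply: sup_norm_le => [|x]; first by rewrite addr_ge0 ?sup_norm_ge0.
by apply: le_trans (ler_normD _ _) _; rewrite lerD // le_sup_norm.
Qed.

Lemma sup_normZ (a : R) f : sup_normed f -> sup_norm (a *: f) = `|a| * sup_norm f.
Proof.
move=> bf; have le_af : sup_norm (a *: f) <= `|a| * sup_norm f.
  apply: sup_norm_le => [|x]; first by rewrite mulr_ge0 ?sup_norm_ge0.
  by rewrite normrM ler_wpM2l // le_sup_norm.
apply/eqP; rewrite eq_le le_af /=.
have [->|a0] := eqVneq a 0; first by rewrite normr0 mul0r sup_norm_ge0.
rewrite -ler_pdivlMl ?normr_gt0 //; apply: sup_norm_le => [|x].
  by rewrite mulr_ge0 ?sup_norm_ge0 // invr_ge0.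
rewrite ler_pdivlMl ?normr_gt0 // -normrM; apply: (@le_sup_norm (a *: f)).
exists (`|a| * sup_norm f) => _ [y _ <-].
by rewrite normrM ler_wpM2l // le_sup_norm.
Qed.

Lemma sup_norm_eq0 f : sup_normed f -> sup_norm f = 0 -> f = 0.
Proof.
move=> bf f0; apply/funext => x; apply/eqP; rewrite -normr_le0 -f0.
exact: le_sup_norm.
Qed.

(* Here [ev g] is the function denoted by [g]; this serves both for [cfun] and
   for [c0]. *)
Lemma cauchy_uniform_limit (V : normedModType R) (ev : V -> T -> R)
    (F : set_system V) : ProperFilter F -> cauchy F ->
  (forall (g h : V) x, `|ev g x - ev h x| <= `|g - h|) ->
  exists f : T -> R, forall e, 0 < e ->
    \forall g \near F, forall x, `|f x - ev g x| <= e.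
Proof.
move=> FF /cauchyP Fc evB.
have cvx x : cvg (ev ^~ x @ F : set_system R).
  apply: R_complete; apply/cauchy_exP => e e0; have [g Fg] := Fc _ e0.
  exists (ev g x); apply: (@filterS _ F _ (ball g e)) Fg => h; rewrite -!ball_normE /=.
  exact: le_lt_trans.
exists (fun x => lim (ev ^~ x @ F)) => e e0.
have [c Fc2] := Fc _ (divr_gt0 e0 (ltr0Sn R 1)).
near=> g => x; apply/ler_addgt0Pr => d d0.
have cg : `|c - g| < e / 2 by near: g; move: Fc2; rewrite -ball_normE.
have /cvgrPdist_le/(_ d d0) Fd := cvx x.
have [h [ch hd]] := filter_ex (filterI Fc2 Fd).
rewrite -ball_normE /= in ch.
rewrite -(subrKA (ev h x)) (le_trans (ler_normD _ _))// addrC lerD//.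
apply: le_trans (evB _ _ _) _; rewrite -(subrKA c) (le_trans (ler_normD _ _))//.
by rewrite [leRHS]splitr lerD// ltW// distrC.
Unshelve. all: by end_near. Qed.

End sup_norm.

Lemma uniform_approx_continuous (K : topologicalType) (R : realType)
    (f : K -> R) :
  (forall e, 0 < e -> exists g : cfun K R, forall x, `|f x - g x| <= e) ->
  continuous f.
Proof.
move=> fg x; apply/cvgrPdist_le => e e0.
have e3 : 0 < e / 3 by rewrite divr_gt0.
have [g fge] := fg _ e3.
have /cvgrPdist_le/(_ _ e3) := @cts_fun _ _ (g : continuousType K R) x.
apply: filterS => y xy.
rewrite -(subrKA (g x)) (le_trans (ler_normD _ _))//.
rewrite -(subrKA (g y) (g x)) .
have -> : e = e / 3 + (e / 3 + e / 3) by field.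
rewrite lerD// (le_trans (ler_normD _ _))// lerD//.
by rewrite distrC.
Qed.

Section cfun_normedModType.
Variables (K : compactHausdorffType) (R : realType).
Implicit Types f g : cfun K R.

Lemma cfun_sup_normed f : sup_normed f.
Proof.
have cf : continuous (f : K -> R) := @cts_fun _ _ (f : continuousType K R).
have /compact_bounded[M [_ fM]] :=
  continuous_compact (continuous_subspaceT cf) (@compact_setT K).
exists (M + 1) => _ [x _ <-].
by apply: (fM (M + 1)); [rewrite ltrDl|exists x].
Qed.

Let ler_normD f g : sup_norm (f + g) <= sup_norm f + sup_norm g.
Proof. exact/ler_sup_normD/cfun_sup_normed/cfun_sup_normed. Qed.

Let normrZ (a : R) f : sup_norm (a *: f) = `|a| * sup_norm f.
Proof. exact/sup_normZ/cfun_sup_normed. Qed.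

Let normr0_eq0 f : sup_norm f = 0 -> f = 0.
Proof.
by move=> f0; apply: val_inj; exact: (sup_norm_eq0 (cfun_sup_normed f) f0).
Qed.

HB.instance Definition _ :=
  Lmodule_isNormed.Build R (cfun K R) ler_normD normrZ normr0_eq0.

Lemma cfun_normE f : `|f| = sup_norm f. Proof. by []. Qed.

Lemma cfun_norm_ge f x : `|f x| <= `|f|.
Proof. exact/le_sup_norm/cfun_sup_normed. Qed.

Let complete (F : set_system (cfun K R)) : ProperFilter F -> cauchy F -> cvg F.
Proof.
move=> FF Fc.
have [|f fF] := @cauchy_uniform_limit K R (cfun K R) (fun g => g) F FF Fc.
  by move=> g h x; exact: (cfun_norm_ge (g - h)).
have cf : continuous f.
  by apply: uniform_approx_continuous => e /fF/filter_ex.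
apply/cvg_ex; exists (mkcts cf : cfun K R); apply/cvgrPdist_le => e e0.
have := fF _ e0; apply: filterS => g fg.
by apply: sup_norm_le => // ; exact: ltW.
Qed.

HB.instance Definition _ := Uniform_isComplete.Build (cfun K R) complete.

End cfun_normedModType.

Definition c0_pred (R : realType) : {pred nat -> R} :=
  mem [set u : nat -> R | u @ \oo --> (0 : R)].

Arguments c0_pred : clear implicits.

Definition c0 (R : realType) : Type := {u : nat -> R | u \in c0_pred R}.

Section c0_normedModType.
Variable R : realType.

HB.instance Definition _ := SubChoice.copy (c0 R) {u | u \in c0_pred R}.

Let c0_submod_closed :
  submod_closed (c0_pred R).
Proof.
split=> [|a u v]; first by rewrite inE /=; exact: cvg_cst.
rewrite !inE /= => u0 v0.
have -> : (0 : R) = a *: (0 : R) + 0 by rewrite scaler0 addr0.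
by apply: cvgD => //; exact: cvgZl_tmp.
Qed.

HB.instance Definition _ := GRing.isSubmodClosed.Build R (nat -> R)
  (c0_pred R) c0_submod_closed.
HB.instance Definition _ := [SubChoice_isSubLmodule of c0 R by <:].

Implicit Types u v : c0 R.

Lemma c0_cvg u : val u @ \oo --> (0 : R).
Proof. exact: set_mem (valP u). Qed.

Lemma c0_sup_normed u : sup_normed (val u).
Proof.
have /cvg_seq_bounded[M [_ uM]] : cvgn (val u).
  by apply/cvg_ex; exists 0; exact: c0_cvg.
by exists (M + 1) => _ [n _ <-]; apply: (uM (M + 1)) => //; rewrite ltrDl.
Qed.

Let ler_normD u v :
  sup_norm (val (u + v)) <= sup_norm (val u) + sup_norm (val v).
Proof. exact/ler_sup_normD/c0_sup_normed/c0_sup_normed. Qed.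

Let normrZ (a : R) u : sup_norm (val (a *: u)) = `|a| * sup_norm (val u).
Proof. exact/sup_normZ/c0_sup_normed. Qed.

Let normr0_eq0 u : sup_norm (val u) = 0 -> u = 0.
Proof.
by move=> u0; apply: val_inj; exact: (sup_norm_eq0 (c0_sup_normed u) u0).
Qed.

HB.instance Definition _ :=
  Lmodule_isNormed.Build R (c0 R) ler_normD normrZ normr0_eq0.

Lemma c0_normE u : `|u| = sup_norm (val u). Proof. by []. Qed.

Lemma c0_norm_ge u n : `|val u n| <= `|u|.
Proof. exact/le_sup_norm/c0_sup_normed. Qed.

Let complete (F : set_system (c0 R)) : ProperFilter F -> cauchy F -> cvg F.
Proof.
move=> FF Fc.
have [|f fF] := @cauchy_uniform_limit nat R (c0 R) val F FF Fc.
  by move=> u v n; exact: (c0_norm_ge (u - v)).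
have f0 : f @ \oo --> (0 : R).
  apply/cvgrPdist_le => e e0; have e2 := divr_gt0 e0 (ltr0Sn R 1).
  have [u fu] := filter_ex (fF _ e2).
  have /cvgrPdist_le/(_ _ e2) := @c0_cvg u.
  apply: filterS => n; rewrite !sub0r !normrN => un.
  rewrite -(subrK (val u n) (f n)) (le_trans (Num.Theory.ler_normD _ _))//.
  by rewrite [leRHS]splitr lerD.
apply/cvg_ex; exists (exist _ f (mem_set f0) : c0 R); apply/cvgrPdist_le => e e0.
have := fF _ e0; apply: filterS => u fu.
by apply: sup_norm_le => // ; exact: ltW.
Qed.

HB.instance Definition _ := Uniform_isComplete.Build (c0 R) complete.

End c0_normedModType.

HB.mixin Record isClosedPred (X : topologicalType) (S : {pred X}) := {
  closed_predP : closed [set` S] }.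

#[short(type="closedSubspace")]
HB.structure Definition ClosedSubspace (R : numFieldType)
    (X : normedModType R) :=
  {S of @isClosedPred X S & @GRing.SubmodClosed R X S}.

(* A subspace as a normed space on its own, to serve as the domain of operators *)
Section subspace_of.
Variables (R : numFieldType) (X : normedModType R) (S : closedSubspace X).

Definition subspace_of : Type := {x : X | x \in S}.

HB.instance Definition _ := SubChoice.copy subspace_of {x : X | x \in S}.
HB.instance Definition _ := [SubChoice_isSubLmodule of subspace_of by <:].

Implicit Types x y : subspace_of.

Let ler_normD x y : `|val (x + y)| <= `|val x| + `|val y|.
Proof. exact: ler_normD. Qed.

Let normrZ (a : R) x : `|val (a *: x)| = `|a| * `|val x|.
Proof. exact: normrZ. Qed.

Let normr0_eq0 x : `|val x| = 0 -> x = 0.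
Proof. by move=> x0; apply: val_inj; exact: normr0_eq0 x0. Qed.

HB.instance Definition _ :=
  Lmodule_isNormed.Build R subspace_of ler_normD normrZ normr0_eq0.

Lemma subspace_normE x : `|x| = `|val x|. Proof. by []. Qed.

End subspace_of.

(* [bounded_fun_norm] is boundedness on bounded sets, that is, for a linear map,
   boundedness as an operator. *)
Definition c0_extension_property (R : realType) (X : completeNormedModType R)
    (Y : closedSubspace X) : Prop :=
  forall T : {linear subspace_of Y -> c0 R}, bounded_fun_norm T ->
  exists S : {linear X -> c0 R},
    bounded_fun_norm S /\ forall y : subspace_of Y, S (val y) = T y.

Section pi1_pullback.
Variable R : realType.

Definition pi1_pullback (f : cfun (unit_itv R) R) : cfun (double_arrow R) R :=
  f \o @pi1 R.

Definition pi1_subalgebra : {pred cfun (double_arrow R) R} :=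
  mem (range pi1_pullback).

Let pi1_subalgebra_submod_closed : submod_closed pi1_subalgebra.
Proof.
split=> [|a f g]; first by apply/mem_set; exists 0 => //; exact: val_inj.
move=> /set_mem[f' _ <-] /set_mem[g' _ <-]; apply/mem_set.
by exists (a *: f' + g') => //; exact: val_inj.
Qed.

HB.instance Definition _ := GRing.isSubmodClosed.Build R
  (cfun (double_arrow R) R) pi1_subalgebra pi1_subalgebra_submod_closed.

Let pi1_subalgebra_closed : closed [set` pi1_subalgebra].
Proof.
move=> g clg; apply/mem_set.
pose f (t : unit_itv R) : R := g (t, false).
have fg e : 0 < e -> exists h : cfun (unit_itv R) R,
    forall z, `|g z - h (pi1 z)| <= e.
  move=> e0; have [_ [/set_mem[h _ <-] gh]] := clg _ (nbhsx_ballx g e e0).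
  exists h => z; apply: le_trans (cfun_norm_ge (g - pi1_pullback h) z) _.
  by move: gh; rewrite -ball_normE /= => /ltW.
have cf : continuous f.
  apply: uniform_approx_continuous => e /fg[h gh]; exists h => t.
  exact: (gh (t, false)).
exists (mkcts cf : cfun (unit_itv R) R) => //.
apply: val_inj; apply/funext => -[t i] /=; rewrite /f.
apply/eqP; rewrite -subr_eq0 -normr_le0; apply/ler_addgt0Pr => e e0.
rewrite add0r; have [h gh] := fg _ (divr_gt0 e0 (ltr0Sn R 1)).
rewrite -(subrKA (h t)) (le_trans (ler_normD _ _))// [leRHS]splitr lerD//.
  exact: (gh (t, false)).
by rewrite distrC; exact: (gh (t, i)).
Qed.

HB.instance Definition _ := isClosedPred.Build
  (cfun (double_arrow R) R) pi1_subalgebra pi1_subalgebra_closed.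

End pi1_pullback.
Arguments pi1_subalgebra : clear implicits.

(* Main.v *)
Require Import Defs.
From HB Require Import structures.
From mathcomp Require Import all_boot all_order all_algebra.
From mathcomp Require Import all_classical all_reals all_analysis.
From mathcomp Require Import lra finmap.

Set Implicit Arguments.
Unset Strict Implicit.
Unset Printing Implicit Defensive.

Import Order.TTheory GRing.Theory Num.Theory.
Import numFieldNormedType.Exports.

Local Open Scope classical_set_scope.
Local Open Scope ring_scope.

(** Let [a_n, b_n) run through the dyadic subintervals of [0, 1).  Since their
    lengths tend to 0, uniform continuity makes T f = (f a_n - f b_n)_n a
    bounded operator from C[0, 1] to c_0 ([dyadic_difference]).  It has no
    bounded extension S to C(DA).

    For t in [0, 1] the set of the z <= (t, 0) is clopen in DA; let [cut t] be
    its indicator function, and phi_n the n-th coordinate of S.  On one hand,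
    phi_n (cut t) tends to 0 for every t, because S takes values in c_0.  On the
    other hand, when a_n <= t < b_n, the function [cut t] differs from a
    continuous function h of the first coordinate, with h a_n = 1 and h b_n = 0,
    only by a function [bump t e] supported above a short interval starting at t,
    and phi_n h = h a_n - h b_n = 1.  So whenever phi_n (cut t) < 1/2, the bump
    has phi_n > 1/2; bumps at finitely many points t can be given disjoint
    supports, so that their sum has norm at most 1, and hence there are at most
    2 ||S|| such points in [a_n, b_n) ([few_small_cuts]).

    Every t in [0, 1) lies in [a_n, b_n) for infinitely many n, hence for one with
    phi_n (cut t) < 1/2.  Then [0, 1) is a countable union of finite sets, which
    is absurd. *)

(** * Dyadic intervals *)

Section dyadic_intervals.
Variable R : realType.
Implicit Types (x : R) (n : nat).

Lemma clip_ge0 x : 0 <= Num.min 1 (Num.max 0 x).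
Proof. by rewrite le_min ler01 le_max lexx. Qed.

Lemma clip_le1 x : Num.min 1 (Num.max 0 x) <= 1.
Proof. by rewrite ge_min lexx. Qed.

(** The retraction of the line onto [0, 1]: it spares the dyadic endpoints
    below a proof of membership. *)
Definition clip x : unit_itv R := to_unit_itv (clip_ge0 x) (clip_le1 x).

Lemma clip_id x : 0 <= x <= 1 -> val (clip x) = x.
Proof. by move=> /andP[x0 x1] /=; rewrite max_r // min_r. Qed.

Lemma clip_dist (x y : R) : x <= y -> `|val (clip x) - val (clip y)| <= y - x.
Proof.
move=> xy /=; rewrite ler_norml.
by case: (lerP 0 x) => x0; case: (lerP 0 y) => y0;
  rewrite /Num.min; case: ltP => ?; case: ltP => ?; apply/andP; split; lra.
Qed.

(** Every n > 0 is uniquely 2^m + k with k < 2^m and m the integer part of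
    log_2 n, and it indexes the interval from k/2^m to (k+1)/2^m; the quotient
    n/2^m - 1 is k/2^m.  The index 0 stands for an empty interval. *)
Definition dyadic_left n : unit_itv R :=
  clip (n%:R / 2 ^+ trunc_log 2 n - 1).

Definition dyadic_right n : unit_itv R :=
  clip (n.+1%:R / 2 ^+ trunc_log 2 n - 1).

Lemma dyadic_length_cvg0 :
  (fun n => val (dyadic_left n) - val (dyadic_right n)) @ \oo --> (0 : R).
Proof.
apply/norm_cvg0P.
apply: (@squeeze_cvgr _ _ _ _ (fun=> 0) (fun n => 2 * n.+1%:R^-1)).
- near=> n; rewrite normr_ge0 /=.
  have P0 : 0 < 2 ^+ trunc_log 2 n :> R by rewrite exprn_gt0.
  apply: le_trans (clip_dist _) _.
    by rewrite lerD2r ler_pM2r ?invr_gt0// ler_nat.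
  rewrite opprB addrA subrK -mulrBl -natrB// subSnn mul1r.
  rewrite -[leLHS]mul1r ler_pdivrMr// mulrAC ler_pdivlMr ?ltr0n// mul1r.
  by rewrite -exprS -natrX ler_nat trunc_log_ltn.
- exact: cvg_cst.
- rewrite -[X in _ --> X](mulr0 2); apply: cvgM; first exact: cvg_cst.
  exact: (@cvg_harmonic R).
Unshelve. all: by end_near. Qed.

(** Each generation m of dyadic intervals covers [0, 1), and its indices are at
    least 2^m; so t is in an interval of every generation N, whose index is the
    integer part of 2^N (1 + t). *)
Lemma dyadic_interval_cover (t : unit_itv R) N : val t < 1 ->
  exists n, [/\ (N <= n)%N, val (dyadic_left n) <= val t
              & val t < val (dyadic_right n)].
Proof.
move=> t1; have t0 := unit_itv_ge0 t.
have P0 : 0 < 2 ^+ N :> R by rewrite exprn_gt0.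
have /truncn_itv : 0 <= 2 ^+ N * (1 + val t) by nra.
set n := Num.truncn _ => /andP[n1 n2].
have nN : (2 ^ N <= n)%N.
  by rewrite truncn_ge_nat ?natrX; nra.
have nN2 : (n < 2 ^ N.+1)%N.
  by rewrite truncn_lt_nat ?natrX ?exprS; nra.
have logn : trunc_log 2 n = N by apply: trunc_log_eq; rewrite ?nN.
have Nn : 2 ^+ N <= n%:R :> R by rewrite -natrX ler_nat.
have Nn2 : n.+1%:R <= 2 * 2 ^+ N :> R by rewrite -exprS -natrX ler_nat.
have nS : n.+1%:R = n%:R + 1 :> R by rewrite -natr1.
exists n; rewrite /dyadic_left /dyadic_right logn !clip_id.
- split.
  + by rewrite (leq_trans _ nN)// ltnW// ltn_expl.
  + by rewrite lerBlDr ler_pdivrMr// mulrC (addrC _ 1).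
  + by rewrite ltrBrDr ltr_pdivlMr// mulrC (addrC _ 1).
- by rewrite subr_ge0 lerBlDr ler_pdivlMr ?ler_pdivrMr//; apply/andP; split; lra.
- by rewrite subr_ge0 lerBlDr ler_pdivlMr ?ler_pdivrMr//; apply/andP; split; lra.
Qed.

End dyadic_intervals.

(** * The operator on C[0, 1] *)

Section difference_operator.
Variable R : realType.
Local Notation Y := (subspace_of (pi1_subalgebra R)).

(** Heine's theorem, from compactness in the form that a property holding
    locally for small d holds globally for small d. *)
Lemma unit_itv_uniform_continuity (f : cfun (unit_itv R) R) (e : R) : 0 < e ->
  exists2 d : R, 0 < d &
    forall s t : unit_itv R, `|val s - val t| < d -> `|f s - f t| <= e.
Proof.
move=> e0.
have /compact_near_coveringP := @unit_itv_compact R.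
move=> /(_ R 0^'+ (fun d s => forall t : unit_itv R,
  `|val s - val t| < d -> `|f s - f t| <= e)).
have FP : Filter (0^'+ : set_system R) by exact: filter_filter.
move=> /(_ FP) cov.
suff {}/cov H : forall x, [set: unit_itv R] x ->
    \forall x' \near x & d \near 0^'+, forall t : unit_itv R,
      `|val x' - val t| < d -> `|f x' - f t| <= e.
  near (0 : R)^'+ => d; exists d; first by near: d; exact: nbhs_right_gt.
  by move=> s; have : [set: unit_itv R] s by []; move: s; near: d.
move=> x _.
have /cvgrPdist_le/(_ _ (divr_gt0 e0 (ltr0Sn R 1))) :=
  @cts_fun _ _ (f : continuousType _ R) x.
case=> _ [[W oW <-] /= Wx] WU.
have /nbhs_ballP[r /= r0 rW] : nbhs (val x) W by exact: open_nbhs_nbhs.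
have fx y : `|val x - val y| < r -> `|f x - f y| <= e / 2.
  by move=> xy; apply: WU; apply: rW.
have r2 : 0 < r / 2 by rewrite divr_gt0.
exists (([set y : unit_itv R | `|val x - val y| < r / 2]), [set d | d < r / 2]).
  split => /=; last exact: nbhs_right_lt.
  have /cvgrPdist_lt/(_ _ r2) := @unit_itv_val_continuous R x.
  by apply: filterS => y /=.
move=> [y d] /= [xy dr] t yt.
rewrite -(subrKA (f x)) (le_trans (ler_normD _ _))// [leRHS]splitr lerD//.
  by rewrite distrC fx// (lt_trans xy)// ltr_pdivrMr// ltr_pMr// ltr1n.
apply: fx; rewrite -(subrKA (val y)) (le_lt_trans (ler_normD _ _))//.
by rewrite [ltRHS]splitr ltrD// (lt_trans yt).
Unshelve. all: by end_near.
Qed.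

Lemma cfun_difference_cvg0 (f : cfun (unit_itv R) R) (a b : nat -> unit_itv R) :
  (fun n => val (a n) - val (b n)) @ \oo --> (0 : R) ->
  (fun n => f (a n) - f (b n)) @ \oo --> (0 : R).
Proof.
move=> ab0; apply/cvgr0Pnorm_le => e e0.
have [d d0 fe] := unit_itv_uniform_continuity f e0.
have /cvgr0Pnorm_lt/(_ _ d0) := ab0.
by apply: filterS => n; exact: fe.
Qed.

Lemma dyadic_difference_c0 (y : Y) :
  (fun n => (val y : cfun _ R) (dyadic_left R n, false)
          - (val y : cfun _ R) (dyadic_right R n, false)) \in c0_pred R.
Proof.
apply/mem_set; have /set_mem[f _ <-] := valP y.
exact: (cfun_difference_cvg0 f (@dyadic_length_cvg0 R)).
Qed.

Definition dyadic_difference (y : Y) : c0 R :=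
  exist (fun u => u \in c0_pred R) _ (dyadic_difference_c0 y).

Lemma dyadic_difference_linear : linear dyadic_difference.
Proof.
move=> c x y; apply: val_inj; apply/funext => n /=.
rewrite scalerBr opprD !addrA; congr (_ - _); rewrite -!addrA; congr (_ + _).
exact: addrC.
Qed.

HB.instance Definition _ :=
  GRing.isLinear.Build R Y (c0 R) _ dyadic_difference dyadic_difference_linear.

Lemma dyadic_difference_bounded : bounded_fun_norm dyadic_difference.
Proof.
move=> r; exists (r + r) => y yr.
apply: sup_norm_le => [|n]; first by rewrite addr_ge0// (le_trans _ yr).
rewrite (le_trans (ler_normB _ _))// lerD// (le_trans (cfun_norm_ge _ _))//.
Qed.

End difference_operator.

(** * Cuts and bumps on the double arrow space *)

Section cuts.
Variable R : realType.
Local Notation DA := (double_arrow R).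
Implicit Types (t : unit_itv R) (e : R).

(** The points (t, 0) and (t, 1) are consecutive, so the interval up to (t, 0) is
    also the open ray below (t, 1). *)
Lemma cut_continuous t :
  continuous (fun z : DA => ((z <= ((t, false) : DA))%O)%:R : R).
Proof.
move=> z; have Fz : Filter (nbhs z) by exact: nbhs_filter.
apply: (@cvg_near_cst _ _ _ _ (nbhs z)).
have [zt|tz] := boolP (z <= ((t, false) : DA))%O.
  have : nbhs z `]-oo, ((t, true) : DA)[%classic.
    apply: open_nbhs_nbhs; split; first exact: lray_open.
    by rewrite /= in_itv /=; apply: le_lt_trans zt _;
      rewrite double_arrow_lt /= lexx.
  apply: filterS => y /=; rewrite in_itv /= => yt.
  suff -> : (y <= ((t, false) : DA))%O by [].
  move: yt; rewrite double_arrow_lt double_arrow_le /= => /andP[-> /implyP H] /=.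
  by apply/implyP => /H; case: (y.2).
have : nbhs z `]((t, false) : DA), +oo[%classic.
  apply: open_nbhs_nbhs; split; first exact: rray_open.
  by rewrite /= in_itv /= andbT ltNge.
by apply: filterS => y /=; rewrite in_itv /= andbT ltNge => /negbTE ->.
Qed.

Definition cut t : cfun DA R := mkcts (@cut_continuous t).

Lemma ramp_continuous t e : continuous
  (fun s : unit_itv R => Num.max 0 (Num.min 1 (1 - (val s - val t) / e))).
Proof.
have cst (c x : R) : {for x, continuous (fun=> c : R^o)} by exact: cvg_cst.
have lin x : {for x, continuous (fun x : R => 1 - (x - val t) / e : R^o)}.
  apply: cvgB; first exact: cvg_cst.
  by apply: cvgMr_tmp; apply: cvgB; [exact: cvg_id|exact: cvg_cst].
have ctmax x : {for x, continuous (fun x : R =>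
    Num.max 0 (Num.min 1 (1 - (x - val t) / e)) : R^o)}.
  exact: (continuous_max (cst 0 _) (continuous_min (cst 1 _) (lin _))).
move=> s; exact: (continuous_comp (@unit_itv_val_continuous R s) (ctmax _)).
Qed.

(** Equal to 1 up to t, to 0 from t + e on, affine in between. *)
Definition ramp t e : cfun (unit_itv R) R := mkcts (@ramp_continuous t e).

Lemma rampE t e s :
  ramp t e s = Num.max 0 (Num.min 1 (1 - (val s - val t) / e)).
Proof. by []. Qed.

Definition bump t e : cfun DA R := pi1_pullback (ramp t e) - cut t.

Lemma bumpE t e (z : DA) :
  bump t e z = ramp t e (pi1 z) - (z <= ((t, false) : DA))%O%:R.
Proof. by []. Qed.

Lemma ramp_le t e (s : unit_itv R) : 0 < e -> val s <= val t -> ramp t e s = 1.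
Proof.
move=> e0 st; rewrite rampE min_l ?max_r// lerDl oppr_ge0.
by rewrite mulr_le0_ge0 ?subr_le0// invr_ge0 ltW.
Qed.

Lemma ramp_ge t e (s : unit_itv R) : 0 < e -> val t + e <= val s -> ramp t e s = 0.
Proof.
move=> e0 st; rewrite rampE max_l// ge_min subr_le0 ler_pdivlMr// mul1r.
by rewrite lerBrDl st orbT.
Qed.

Lemma ramp_itv t e (s : unit_itv R) : 0 <= ramp t e s <= 1.
Proof. by rewrite rampE le_max lexx /= ge_max ler01 ge_min lexx. Qed.

Lemma bump_itv t e z : 0 < e -> 0 <= bump t e z <= 1.
Proof.
move=> e0; rewrite bumpE.
have [zt|_] := boolP (z <= ((t, false) : DA))%O; last by rewrite subr0 ramp_itv.
rewrite ramp_le ?subrr ?lexx ?ler01//.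
by move: zt; rewrite double_arrow_le => /andP[].
Qed.

(** Below t both the ramp and the cut are 1, beyond t + e both are 0.  At t only
    the point (t, 1) is in the support. *)
Lemma bump_support t e z : 0 < e -> bump t e z != 0 ->
  val t <= val (pi1 z) < val t + e.
Proof.
move=> e0; apply: contra_neqT; rewrite negb_and -ltNge -leNgt bumpE.
have -> : (z <= ((t, false) : DA))%O =
    (val (pi1 z) <= val t) && ((val t <= val (pi1 z)) ==> ~~ z.2).
  by rewrite double_arrow_le; case: (z.2).
case/orP => [zt|tz].
  by rewrite ramp_le ?(ltW zt)// leNgt zt subrr.
by rewrite ramp_ge// leNgt (lt_le_trans _ tz) ?ltrDl// subrr.
Qed.

(** The gaps make the supports disjoint, so at each point at most one bump, with
    values in [0, 1], contributes to the sum. *)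
Lemma sum_bump_le1 (s : seq (unit_itv R)) (e : R) : uniq s -> 0 < e ->
  (forall t t', t \in s -> t' \in s -> t != t' -> e <= `|val t - val t'|) ->
  `|\sum_(t <- s) bump t e| <= 1.
Proof.
move=> us e0 gap; apply: sup_norm_le => // z.
have -> : (\sum_(t <- s) bump t e) z = \sum_(t <- s) bump t e z.
  by elim/big_ind2 : _ => // f x g y <- <-.
have [|/hasPn s0] := boolP (has (fun t => bump t e z != 0) s).
  move=> /hasP[t ts tz]; rewrite (bigD1_seq t)//= big1_seq ?addr0; last first.
    move=> t' /andP[t't t's]; apply/eqP; apply: contraT => t'z.
    have := gap _ _ t's ts t't; rewrite leNgt ltr_norml.
    have /andP[? ?] := bump_support e0 tz; have /andP[? ?] := bump_support e0 t'z.
    by move=> /negP[]; apply/andP; split; lra.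
  by have /andP[z0 z1] := bump_itv t z e0; rewrite ger0_norm.
by rewrite big1_seq ?normr0// => t /s0; rewrite negbK => /eqP.
Qed.

End cuts.

Lemma seq_pos_lower_bound (R : realType) (s : seq R) :
  (forall x, x \in s -> 0 < x) -> exists2 e, 0 < e & forall x, x \in s -> e <= x.
Proof.
elim: s => [|x s IH] s0; first by exists 1.
have [y ys|e e0 es] := IH; first by apply: s0; rewrite inE ys orbT.
exists (Num.min x e); first by rewrite lt_min e0 s0 ?mem_head.
by move=> y; rewrite inE ge_min => /predU1P[->|/es ->]; rewrite ?lexx ?orbT.
Qed.

(** * Functionals on C(DA) that extend a difference of point masses *)

Section few_small_cuts.
Variable R : realType.
Local Notation DA := (double_arrow R).
Variables (phi : {scalar (cfun DA R)}) (M : R) (a b : unit_itv R).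
Hypothesis phi_bounded : forall f : cfun DA R, `|f| <= 1 -> `|phi f| <= M.
Hypothesis phi_pullback : forall f : cfun (unit_itv R) R,
  phi (pi1_pullback f) = f a - f b.

(** Each small cut gives a bump on which phi is greater than 1/2, and the sum of
    any number of such bumps, if narrow enough, has norm at most 1; so there are
    at most 2M of them. *)
Lemma few_small_cuts : finite_set [set t : unit_itv R |
  [/\ val a <= val t, val t < val b & phi (cut t) < 1 / 2]].
Proof.
set E := [set t | _].
apply: contrapT => /(infinite_set_fset (Num.truncn (2 * M)).+1)[B BE cB].
pose s : seq (unit_itv R) := enum_fset B.
have sE t : t \in s -> E t by exact: BE.
have us : uniq s by exact: fset_uniq.
(* The width e must not exceed the distance between two of the points, so that
   the supports are disjoint, nor the distance from a point to b, so that the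
   ramps vanish at b; the value 1 fills the diagonal of the list. *)
have [|e e0 es] := @seq_pos_lower_bound R
    ([seq val b - val t | t <- s] ++
     [seq if t == t' then 1 else `|val t - val t'| | t <- s, t' <- s]).
  move=> x; rewrite mem_cat => /orP[/mapP[t /sE[_ tb _] ->]|].
    by rewrite subr_gt0.
  move=> /allpairsP[[t t'] /= [_ _ ->]]; case: eqP => // tt'.
  by rewrite normr_gt0 subr_eq0; apply/eqP => /val_inj.
have eb t : t \in s -> val t + e <= val b.
  move=> ts; rewrite -lerBrDl; apply: es.
  by rewrite mem_cat; apply/orP; left; apply/mapP; exists t.
have gap t t' : t \in s -> t' \in s -> t != t' -> e <= `|val t - val t'|.
  move=> ts t's tt'; apply: es; rewrite mem_cat; apply/orP; right.
  by apply/allpairsP; exists (t, t') => /=; rewrite (negbTE tt').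
have := phi_bounded (sum_bump_le1 us e0 gap).
rewrite raddf_sum => /(le_trans (ler_norm _)).
apply/negP; rewrite -ltNge.
apply: (@lt_le_trans _ _ (\sum_(t <- s) (1 / 2 : R))).
  rewrite big_const_seq count_predT iter_addr_0 -[_ *+ _]mulr_natl mulrA mulr1.
  rewrite ltr_pdivlMr// mulrC; apply: lt_le_trans (truncnS_gt _) _.
  by rewrite ler_nat; exact: cB.
rewrite big_seq [leRHS]big_seq; apply: ler_sum => t ts.
have [at_ tb small] := sE _ ts.
rewrite raddfB /= phi_pullback ramp_le// ramp_ge ?eb// subr0.
by lra.
Qed.

End few_small_cuts.

(** * The contradiction *)

Section coordinate.
Variable R : realType.

Definition c0_coord n (u : c0 R) : R := val u n.

Lemma c0_coord_linear n : scalar (c0_coord n).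
Proof. by []. Qed.

HB.instance Definition _ n :=
  GRing.isLinear.Build R (c0 R) R *%R (c0_coord n) (c0_coord_linear n).

End coordinate.

(** A countable set has Lebesgue measure 0. *)
Lemma unit_itv_uncountable (R : realType) :
  ~ countable [set t : unit_itv R | val t < 1].
Proof.
move=> ct.
have : countable (`[0, 1[%classic : set R).
  apply: sub_countable (sub_countable (card_image_le val _) ct).
  apply: subset_card_le => x /=; rewrite in_itv /= => /andP[x0 x1].
  by exists (to_unit_itv x0 (ltW x1)).
move=> /countable_lebesgue_measure0.
rewrite lebesgue_measure_itv /= lte_fin ltr01 oppr0 adde0 => /eqP.
by rewrite eqe oner_eq0.
Qed.

Theorem proposition2p9 (R : realType) :
  ~ c0_extension_property (pi1_subalgebra R).
Proof.
move=> /(_ (@dyadic_difference R) (@dyadic_difference_bounded R)).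
move=> [S [/(_ 1)[M SM] ST]].
pose phi n : {scalar (cfun (double_arrow R) R)} := c0_coord n \o S.
pose E n := [set t : unit_itv R | [/\ val (dyadic_left R n) <= val t,
  val t < val (dyadic_right R n) & phi n (cut t) < 1 / 2]].
apply: (@unit_itv_uncountable R).
apply: (@sub_countable _ _ _ (\bigcup_(n in setT) E n)); last first.
  apply: bigcup_countable => // n _; apply: finite_set_countable.
  apply: (@few_small_cuts R (phi n) M) => [f f1|f].
    exact: le_trans (c0_norm_ge _ _) (SM _ f1).
  have fY : pi1_pullback f \in pi1_subalgebra R by apply/mem_set; exists f.
  by have := ST (exist (fun g => g \in pi1_subalgebra R) _ fY); rewrite /phi /= /c0_coord => ->.
apply: subset_card_le => t t1.
have /cvgr0Pnorm_lt/(_ _ (divr_gt0 ltr01 (ltr0Sn R 1))) := @c0_cvg R (S (cut t)).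
move=> [N _ NS].
have [n [Nn lt tr]] := dyadic_interval_cover N t1.
by exists n => //; split => //; apply: le_lt_trans (ler_norm _) (NS _ Nn).
Qed.
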